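(* Let $\mathbf D$ be a $k$-ary dependency that is domain independent, union closed and strongly first order. Then $\mathbf D(R)$ is equivalent to some finite disjunction $\bigvee_{i=1}^n\chi_i(R)$ of U-sentences over the signature $\{R\}$; that is, for every structure $(A,R)$ with $R\subseteq A^k$, $(A,R)\in\mathbf D$ iff $(A,R)\models\bigvee_{i=1}^n\chi_i(R)$.
   Context: Team semantics: for a first order model $\mathcal M$ with domain $M$, a team $X$ is a set of assignments $s: V\to M$; $X(\vec v)=\{s(\vec v): s\in X\}$. Formulas are in negation normal form; $\mathcal M\models_X\phi$: literals hold at every $s\in X$ (Tarskian sense); $\phi_1\vee\phi_2$ iff $X=Y\cup Z$ with $Y\models\phi_1$, $Z\models\phi_2$; $\wedge$ componentwise; $\exists v\psi$ iff some $H:X\to\mathcal P(M)\setminus\{\emptyset\}$ has $\mathcal M\models_{X[H/v]}\psi$ with $X[H/v]=\{s[m/v]:s\in X,m\in H(s)\}$; $\forall v\psi$ iff $\mathcal M\models_{X[M/v]}\psi$ with $X[M/v]=\{s[m/v]:s\in X,m\in M\}$. A sentence is true in $\mathcal M$ iff satisfied by $\{\epsilon\}$. A $k$-ary dependency $\mathbf D$ is a class, closed under isomorphism, of structures $(A,R)$ with $R\subseteq A^k$; the atom $\mathbf D\vec x$ holds in $X$ iff $(M,X(\vec x))\in\mathbf D$. $\mathbf D$ is strongly first order if every sentence of $\mathbf{FO}(\mathbf D)$ (first order logic with team semantics plus these atoms) is equivalent to a first order sentence; such $\mathbf D$ is first order, i.e. there is a first order sentence $\mathbf D(R)$ over $\{R\}$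 with $(A,R)\in\mathbf D\iff(A,R)\models\mathbf D(R)$. $\mathbf D$ is domain independent if $(A,R)\in\mathbf D\iff(\mathrm{Fld}(R),R)\in\mathbf D$, with $\mathrm{Fld}(R)$ the set of elements occurring in tuples of $R$. $\mathbf D$ is union closed if whenever $(R_i)_{i\in I}$ (any index set $I$, possibly empty) are relations over $A$ with $(A,R_i)\in\mathbf D$ for all $i$, then $(A,\bigcup_i R_i)\in\mathbf D$. A U-sentence over $\{R\}$ is a sentence of the form $\exists\vec x\,(\eta(\vec x)\wedge\forall\vec y\,(R\vec y\to\theta(\vec x,\vec y)))$ with $\vec x,\vec y$ disjoint tuples of variables, $\eta$ a conjunction of first order literals in which $R$ occurs only positively, and $\theta$ a first order formula not containing $R$. *)

(* Defs.v *)
(* MathComp, with the sets of mathcomp-classical. *)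
From mathcomp Require Import all_boot.
From mathcomp Require Import boolp classical_sets.

Set Implicit Arguments.
Unset Strict Implicit.
Unset Printing Implicit Defensive.

Local Open Scope classical_set_scope.

(** First order syntax and Tarskian semantics *)

Record signature := Signature {
  fsym : Type;
  farity : fsym -> nat;
  rsym : Type;
  rarity : rsym -> nat
}.

(* Carriers may be empty; nonemptiness is required explicitly where logical
   equivalence of sentences is at stake (see [strongly_first_order]). *)
Record structure (L : signature) := Structure {
  carrier :> Type;
  finterp : forall f : fsym L, (farity f).-tuple carrier -> carrier;
  rinterp : forall r : rsym L, set ((rarity r).-tuple carrier)
}.

(* Syntax is well scoped: an expression indexed by n has its free variables
   among v_0, ..., v_(n-1), and is evaluated at assignments in n.-tuple M.  A
   quantifier binds the variable of index 0 of its body, the other indices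
   being shifted by one, so that s[m/v] is [tuple of m :: s].  Sentences are the
   formulas of index 0, and [tuple] is the empty assignment. *)
Inductive term (L : signature) (n : nat) : Type :=
| Var of 'I_n
| App (f : fsym L) of ('I_(farity f) -> term L n).

Inductive atom (L : signature) (n : nat) : Type :=
| ATop
| AEq of term L n & term L n
| ARel (r : rsym L) of (rarity r).-tuple (term L n).

Arguments ATop {L n}.

Record literal (L : signature) (n : nat) := Literal {
  positive : bool;
  atom_of : atom L n
}.

(* Formulas are in negation normal form. *)
Inductive fo (L : signature) : nat -> Type :=
| FLit n : literal L n -> fo L n
| FAnd n : fo L n -> fo L n -> fo L n
| FOr n : fo L n -> fo L n -> fo L n
| FEx n : fo L n.+1 -> fo L n
| FAll n : fo L n.+1 -> fo L n.

Definition FTop L n : fo L n := FLit (Literal true ATop).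
Definition FBot L n : fo L n := FLit (Literal false ATop).
Arguments FTop {L n}.
Arguments FBot {L n}.

Section Tarski.
Variables (L : signature) (M : structure L).

Fixpoint eval n (s : n.-tuple M) (t : term L n) : M :=
  match t with
  | Var i => tnth s i
  | App f ts => finterp [tuple eval s (ts i) | i < farity f]
  end.

Definition atom_sat n (s : n.-tuple M) (a : atom L n) : Prop :=
  match a with
  | ATop => True
  | AEq t1 t2 => eval s t1 = eval s t2
  | ARel r ts => rinterp (map_tuple (eval s) ts)
  end.

Definition lit_sat n (s : n.-tuple M) (l : literal L n) : Prop :=
  if positive l then atom_sat s (atom_of l) else ~ atom_sat s (atom_of l).

Fixpoint fo_sat n (phi : fo L n) : n.-tuple M -> Prop :=
  match phi in fo _ n return n.-tuple M -> Prop with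
  | FLit _ l => fun s => lit_sat s l
  | FAnd _ p q => fun s => fo_sat p s /\ fo_sat q s
  | FOr _ p q => fun s => fo_sat p s \/ fo_sat q s
  | FEx _ p => fun s => exists m : M, fo_sat p [tuple of m :: s]
  | FAll _ p => fun s => forall m : M, fo_sat p [tuple of m :: s]
  end.

Definition fo_true (phi : fo L 0) : Prop := fo_sat phi [tuple].

End Tarski.

(** Dependencies *)

Record dependency (k : nat) := Dependency {
  dep_mem :> forall A : Type, set (k.-tuple A) -> Prop;
  dep_iso : forall (A B : Type) (f : A -> B) (R : set (k.-tuple A)),
    bijective f -> dep_mem R <-> dep_mem (map_tuple f @` R)
}.

Arguments dep_mem {k} _ A R.

Definition Fld (k : nat) (A : Type) (R : set (k.-tuple A)) : set A :=
  [set a | exists2 t, R t & exists i : 'I_k, tnth t i = a].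

(* R viewed as a relation over the type of the elements of Fld R. *)
Definition Fld_restr (k : nat) (A : Type) (R : set (k.-tuple A)) :
    set (k.-tuple {a : A | Fld R a}) :=
  map_tuple sval @^-1` R.

Arguments Fld_restr {k A} R.

Definition domain_independent (k : nat) (D : dependency k) : Prop :=
  forall (A : Type) (R : set (k.-tuple A)), D A R <-> D _ (Fld_restr R).

Definition union_closed (k : nat) (D : dependency k) : Prop :=
  forall (A I : Type) (R : I -> set (k.-tuple A)),
    (forall i, D A (R i)) -> D A (\bigcup_i R i).

(** Team semantics *)

(* Formulas of FO(D), for D a k-ary dependency. *)
Inductive team_fo (L : signature) (k : nat) : nat -> Type :=
| TLit n : literal L n -> team_fo L k n
| TDep n : k.-tuple 'I_n -> team_fo L k n
| TAnd n : team_fo L k n -> team_fo L k n -> team_fo L k n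
| TOr n : team_fo L k n -> team_fo L k n -> team_fo L k n
| TEx n : team_fo L k n.+1 -> team_fo L k n
| TAll n : team_fo L k n.+1 -> team_fo L k n.

Section Team.
Variables (k : nat) (D : dependency k) (L : signature) (M : structure L).

(* X(x) = {s(x) : s in X} *)
Definition team_image n (X : set (n.-tuple M)) (x : k.-tuple 'I_n) :
    set (k.-tuple M) :=
  [set map_tuple (tnth s) x | s in X].

(* X[H/v]; only the values of H on X matter. *)
Definition team_supplement n (X : set (n.-tuple M)) (H : n.-tuple M -> set M) :
    set (n.+1.-tuple M) :=
  [set t | exists s m, [/\ X s, H s m & t = [tuple of m :: s]]].

(* X[M/v] *)
Definition team_duplicate n (X : set (n.-tuple M)) : set (n.+1.-tuple M) :=
  [set t | exists s m, X s /\ t = [tuple of m :: s]].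

Fixpoint team_sat n (phi : team_fo L k n) : set (n.-tuple M) -> Prop :=
  match phi in team_fo _ _ n return set (n.-tuple M) -> Prop with
  | TLit _ l => fun X => forall s, X s -> lit_sat s l
  | TDep _ x => fun X => D M (team_image X x)
  | TAnd _ p q => fun X => team_sat p X /\ team_sat q X
  | TOr _ p q => fun X =>
      exists Y Z, [/\ X = Y `|` Z, team_sat p Y & team_sat q Z]
  | TEx n p => fun X => exists H : n.-tuple M -> set M,
      (forall s, X s -> H s !=set0) /\ team_sat p (team_supplement X H)
  | TAll _ p => fun X => team_sat p (team_duplicate X)
  end.

Definition team_true (phi : team_fo L k 0) : Prop :=
  team_sat phi [set [tuple]].

End Team.

Definition strongly_first_order (k : nat) (D : dependency k) : Prop :=
  forall (L : signature) (phi : team_fo L k 0),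
    exists psi : fo L 0, forall M : structure L, inhabited M ->
      (team_true D M phi <-> fo_true M psi).

(** U-sentences *)

Definition rel_sig (k : nat) : signature :=
  {| fsym := void; farity := fun=> 0; rsym := unit; rarity := fun=> k |}.

Definition rel_structure (k : nat) (A : Type) (R : set (k.-tuple A)) :
    structure (rel_sig k) :=
  @Structure (rel_sig k) A (fun f _ => match f with end) (fun=> R).

Definition is_rel_atom L n (a : atom L n) : bool :=
  if a is ARel _ _ then true else false.

Definition rel_positive L n (l : literal L n) : bool :=
  is_rel_atom (atom_of l) ==> positive l.

Fixpoint rel_free L n (phi : fo L n) : bool :=
  match phi with
  | FLit _ l => ~~ is_rel_atom (atom_of l)
  | FAnd _ p q => rel_free p && rel_free q
  | FOr _ p q => rel_free p && rel_free q
  | FEx _ p => rel_free p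
  | FAll _ p => rel_free p
  end.

Fixpoint fo_exs L (m : nat) : fo L m -> fo L 0 :=
  match m return fo L m -> fo L 0 with
  | 0 => id
  | m'.+1 => fun phi => fo_exs (FEx phi)
  end.

Fixpoint fo_alls L (m k : nat) : fo L (k + m) -> fo L m :=
  match k return fo L (k + m) -> fo L m with
  | 0 => id
  | k'.+1 => fun phi => @fo_alls L m k' (FAll phi)
  end.

(* With m variables x and k variables y in scope, y_i has index i and x_j has
   index k + j; this is the literal ~ R y. *)
Definition not_R (k m : nat) : fo (rel_sig k) (k + m) :=
  FLit (Literal false
    (@ARel (rel_sig k) _ tt [tuple Var _ (lshift m i) | i < k])).

(* The sentence  exists x, (/\ eta) /\ forall y, (R y -> theta),  with the
   implication in negation normal form. *)
Definition U_form (k m : nat) (eta : seq (literal (rel_sig k) m))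
    (theta : fo (rel_sig k) (k + m)) : fo (rel_sig k) 0 :=
  fo_exs (FAnd (\big[@FAnd _ m/FTop]_(l <- eta) FLit l)
               (fo_alls (FOr (not_R k m) theta))).

Definition U_sentence (k : nat) (chi : fo (rel_sig k) 0) : Prop :=
  exists (m : nat) (eta : seq (literal (rel_sig k) m))
         (theta : fo (rel_sig k) (k + m)),
    [/\ all (@rel_positive _ m) eta, rel_free theta & chi = U_form eta theta].

(* Main.v *)
Require Import Defs.
From mathcomp Require Import all_boot.
From mathcomp Require Import boolp classical_sets filter.

(* Call a relation in D undetected if it satisfies no U-sentence that implies D.
   By compactness (an ultraproduct over finite lists of U-sentences) the theorem
   amounts to the absence of undetected relations.

   If (A, R) is undetected, the U-sentences describing R from finite tuples of A
   have models outside D, whose ultraproduct extends (a copy of) R by tuples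
   whose equality types over finite subsets of A are all realised in R.  By
   union closure R + {s} is already outside D for one such s.  A tuple with the
   type of s is found in an ultrapower R' of R, which is undetected again; so
   R <= R + {s} <= R' with only the middle relation outside D, and the step can
   be iterated to chains R_0 <= S_0 <= R_1 <= S_1 <= ... of any finite length
   with R_i in D and S_i not in D.

   Such chains contradict strong first orderness: that some nonempty family of
   the S_i has its union in D is expressible in FO(D).  It is false along a
   finite chain, whose nonempty subfamilies have a largest element, but true in
   an ultraproduct of longer and longer chains, where the union of the S_i with i
   standard is the union of the R_i. *)

Set Implicit Arguments.
Unset Strict Implicit.
Unset Printing Implicit Defensive.

Local Open Scope classical_set_scope.

(** * Invariance and closure of dependencies *)

Lemma sval_inj (T : Type) (P : T -> Prop) : injective (@sval T P).
Proof.
move=> [x Px] [y Py] /= xy; case: y / xy Py => Py.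
by congr exist; exact: Prop_irrelevance.
Qed.

Lemma map_tuple_comp k (A B C : Type) (f : A -> B) (g : B -> C) (t : k.-tuple A) :
  map_tuple g (map_tuple f t) = map_tuple (g \o f) t.
Proof. by apply: eq_from_tnth => i; rewrite !tnth_map. Qed.

Lemma map_tuple_inj k (A B : Type) (f : A -> B) :
  injective f -> injective (@map_tuple k A B f).
Proof.
move=> fI s t st; apply: eq_from_tnth => i; apply: fI.
by have := congr1 (fun t => tnth t i) st; rewrite !tnth_map.
Qed.

Lemma inj_surj_bijective (A B : Type) (f : A -> B) :
  injective f -> (forall b, exists a, f a = b) -> bijective f.
Proof.
move=> fI fS; have [g gP] := boolp.choice fS.
by exists g => [a|b]; [apply: fI; rewrite gP | exact: gP].
Qed.

Section Invariance.
Variables (k : nat) (D : dependency k).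
Hypothesis D_domain_independent : domain_independent D.

(** Domain independence moves both sides to the fields of the two relations, and an injection
    restricts to a bijection between these fields, where closure under isomorphism applies. *)
Lemma dep_inj (A B : Type) (f : A -> B) (R : set (k.-tuple A)) :
  injective f -> D A R <-> D B (map_tuple f @` R).
Proof.
move=> fI; rewrite D_domain_independent [X in _ <-> X]D_domain_independent.
have FldP a : Fld R a <-> Fld (map_tuple f @` R) (f a).
  split=> [[t Rt [i <-]]|[_ [t Rt <-] [i]]].
    by exists (map_tuple f t); [exists t | exists i; rewrite tnth_map].
  by rewrite tnth_map => /fI <-; exists t => //; exists i.
pose g (x : {a | Fld R a}) : {b | Fld (map_tuple f @` R) b} :=
  exist _ (f (sval x)) ((FldP _).1 (svalP x)).
have gI : injective g.
  by move=> a b /(congr1 sval)/= /fI /sval_inj.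
have gS b : exists a, g a = b.
  case: b => b Hb; have [_ [t Rt <-] [i tib]] := Hb.
  rewrite tnth_map in tib; rewrite -{}tib in Hb *.
  have Ra : Fld R (tnth t i) by exists t => //; exists i.
  by exists (exist _ _ Ra); exact: sval_inj.
have -> : Fld_restr (map_tuple f @` R) = map_tuple g @` Fld_restr R.
  apply/seteqP; split=> [t [s Rs st]|_ [t Rt <-]].
    have [h hP] := boolp.choice gS.
    exists (map_tuple h t); last first.
      by apply: eq_from_tnth => i; rewrite !tnth_map hP.
    suff E : s = map_tuple sval (map_tuple h t) by move: Rs; rewrite E.
    apply: (map_tuple_inj fI); rewrite st.
    apply: eq_from_tnth => i; rewrite !tnth_map.
    by rewrite -[in LHS](hP (tnth t i)).
  exists (map_tuple sval t) => //.
  by apply: eq_from_tnth => i; rewrite !tnth_map.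
exact/dep_iso/inj_surj_bijective.
Qed.

(** Compares relations over carriers with no map between them, through common names in [Z]. Choosing
    one name per class of the shared kernel gives a type [Q] that embeds into both carriers. *)
Lemma dep_eqker (Z A B : Type) (u : Z -> A) (v : Z -> B) (W : set (k.-tuple Z)) :
  (forall z z', u z = u z' <-> v z = v z') ->
  D A (map_tuple u @` W) -> D B (map_tuple v @` W).
Proof.
move=> uv.
have hP z : exists z', u z' = u z by exists z.
pose h z := sval (cid (hP z)).
have uh z : u (h z) = u z by rewrite /h; case: cid.
have hE z z' : u z = u z' -> h z = h z'.
  (* The predicate given to [cid] mentions [z] only through [u z], so equal values yield the same
     representative. *)
  move=> uzz'; rewrite /h; move: (hP z) (hP z'); rewrite uzz' => p p'.
  by rewrite (Prop_irrelevance p p').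
have vh z : v (h z) = v z by apply/uv.
pose Q := {z | h z = z}.
have hh z : h (h z) = h z by apply: hE.
pose q z : Q := exist _ (h z) (hh z).
have uQ : injective (fun x : Q => u (sval x)).
  move=> [x hx] [y hy] /= uxy.
  by apply: sval_inj; rewrite /= -hx -hy; exact: hE.
have vQ : injective (fun x : Q => v (sval x)).
  by move=> x y /uv; exact: uQ.
have H C (w : Z -> C) : (forall z, w (h z) = w z) ->
    map_tuple w @` W = map_tuple (fun x : Q => w (sval x)) @` (map_tuple q @` W).
  move=> wh; rewrite image_comp; apply: eq_imagel => t _ /=.
  by apply: eq_from_tnth => i; rewrite !tnth_map /= wh.
rewrite (H _ _ uh) (H _ _ vh) => DA.
by apply/(dep_inj _ vQ)/(dep_inj _ uQ).
Qed.

End Invariance.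

Lemma union_closed_set0 k (D : dependency k) (A : Type) :
  union_closed D -> D A set0.
Proof.
move=> /(_ A void (fun=> set0)) H.
by have : D A (\bigcup_(i : void) set0) by [apply: H => -[]]; rewrite bigcup0.
Qed.

Lemma union_closed_setU k (D : dependency k) (A : Type) (R S : set (k.-tuple A)) :
  union_closed D -> D A R -> D A S -> D A (R `|` S).
Proof.
move=> U DR DS.
suff <- : \bigcup_(b : bool) (if b then R else S) = R `|` S.
  by apply: U => -[].
apply/seteqP; split=> [t [[] _ ?]|t [?|?]]; by [left|right|exists true|exists false].
Qed.

(** * Semantics of guarded team formulas and of U-sentences *)

Lemma cat_tuple0 n (T : Type) (t : 0.-tuple T) (s : n.-tuple T) :
  cat_tuple t s = s.
Proof. by apply: val_inj => /=; case: t => -[]. Qed.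

Lemma cat_tuple_cons n m (T : Type) (x : T) (t : n.-tuple T) (s : m.-tuple T) :
  cat_tuple [tuple of x :: t] s = [tuple of x :: cat_tuple t s].
Proof. exact: val_inj. Qed.

Lemma map_cat_tuple n m (T U : Type) (f : T -> U) (t : n.-tuple T) (s : m.-tuple T) :
  map_tuple f (cat_tuple t s) = cat_tuple (map_tuple f t) (map_tuple f s).
Proof. by apply: val_inj; rewrite /= map_cat. Qed.

Lemma tuple_consE n (T : Type) (t : n.+1.-tuple T) :
  exists x (s : n.-tuple T), t = [tuple of x :: s].
Proof. by exists (thead t), [tuple of behead t]; exact: tuple_eta. Qed.

Section Guard.
Variables (k : nat) (D : dependency k) (L : signature) (M : structure L).

Fixpoint team_alls (m j : nat) : team_fo L k (j + m) -> team_fo L k m :=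
  match j return team_fo L k (j + m) -> team_fo L k m with
  | 0 => id
  | j'.+1 => fun phi => @team_alls m j' (TAll phi)
  end.

Lemma team_sat_alls m j (phi : team_fo L k (j + m)) (X : set (m.-tuple M)) :
  team_sat D (team_alls phi) X <->
  team_sat D phi [set t | exists y s, X s /\ t = cat_tuple y s].
Proof.
elim: j phi => [|j IH] phi.
  suff -> : [set t | exists (y : 0.-tuple M) s, X s /\ t = cat_tuple y s] = X by [].
  apply/seteqP; split=> [_ [y [s [Xs ->]]]|s Xs]; first by rewrite cat_tuple0.
  by exists [tuple], s; rewrite cat_tuple0.
rewrite [team_alls _]/(team_alls (TAll phi)) IH /=.
set Y := team_duplicate _; set Y' := [set t | _]; suff -> : Y = Y' by [].
apply/seteqP; split=> [_ [_ [x [[y [s [Xs ->]]] ->]]]|_ [t [s [Xs ->]]]].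
  by exists [tuple of x :: y], s; rewrite cat_tuple_cons.
have [x [y ->]] := tuple_consE t.
by exists (cat_tuple y s), x; split; [exists y, s | rewrite cat_tuple_cons].
Qed.

(* Splitting along the two sides of [a] isolates exactly the part of the team
   where [a] holds, so the dependency is applied to a definable relation. *)
Definition team_guard m (a : atom L (k + m)) : team_fo L k m :=
  team_alls (TOr (TLit _ (Literal false a))
    (TAnd (TLit _ (Literal true a)) (TDep _ [tuple lshift m i | i < k]))).

Lemma team_sat_guard m (a : atom L (k + m)) (X : set (m.-tuple M)) :
  team_sat D (team_guard a) X <->
  D M [set y | exists2 s, X s & atom_sat (cat_tuple y s) a].
Proof.
have lshiftE (y : k.-tuple M) (s : m.-tuple M) :
    map_tuple (tnth (cat_tuple y s)) [tuple lshift m i | i < k] = y.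
  by apply: eq_from_tnth => i; rewrite tnth_map tnth_mktuple tnth_lshift.
rewrite team_sat_alls; set T := [set t | _] => /=.
have imE (Z : set ((k + m).-tuple M)) :
    (forall t, Z t <-> T t /\ atom_sat t a) ->
    team_image Z [tuple lshift m i | i < k] =
    [set y | exists2 s, X s & atom_sat (cat_tuple y s) a].
  move=> ZE; apply/seteqP; split=> [_ [t /ZE[[y [s [Xs ->]]] ta] <-]|y [s Xs ya]].
    by rewrite lshiftE; exists s.
  by exists (cat_tuple y s); [apply/ZE; split => //; exists y, s | rewrite lshiftE].
split=> [[Y [Z [TE Ya [Za]]]]|DX].
  rewrite imE // => t; split=> [Zt|[]].
    by split; [rewrite TE; right | exact: Za].
  by rewrite TE => -[/Ya|].
exists (T `&` [set t | ~ atom_sat t a]), (T `&` [set t | atom_sat t a]); split.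
- by rewrite -setIUr setUC setUv setIT.
- by move=> t [].
- by split=> [t []//|]; rewrite imE.
Qed.

End Guard.

Lemma strongly_first_order_definable k (D : dependency k) :
  strongly_first_order D ->
  exists delta : fo (rel_sig k) 0, forall (A : Type) (R : set (k.-tuple A)),
    inhabited A -> (D A R <-> fo_true (rel_structure R) delta).
Proof.
(* Guarded by the atom R y alone, the dependency is applied to R itself. *)
pose a : atom (rel_sig k) (k + 0) :=
  @ARel (rel_sig k) _ tt [tuple Var _ (lshift 0 i) | i < k].
move=> /(_ _ (team_guard a)) [delta deltaP].
exists delta => A R iA; rewrite -(deltaP (rel_structure R) iA).
rewrite /team_true team_sat_guard.
set S := [set y | _]; suff -> : S = R by [].
have aE (y : k.-tuple A) (s : 0.-tuple A) :
    map_tuple (eval (M := rel_structure R) (cat_tuple y s))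
      [tuple Var _ (lshift 0 i) | i < k] = y.
  by apply: eq_from_tnth => i; rewrite tnth_map tnth_mktuple /= tnth_lshift.
apply/seteqP; split=> [y [s _]|y Ry]; first by rewrite /= aE.
by exists [tuple]; rewrite //= aE.
Qed.

Lemma fo_sat_bigAnd L (M : structure L) n (I : eqType) (r : seq I) (F : I -> fo L n)
    (s : n.-tuple M) :
  fo_sat (\big[@FAnd L n/FTop]_(i <- r) F i) s <->
  forall i, i \in r -> fo_sat (F i) s.
Proof.
elim: r => [|i r IH]; first by rewrite big_nil.
rewrite big_cons /= IH; split=> [[Hi Hr] j|H].
  by rewrite inE => /orP[/eqP->//|/Hr].
by split=> [|j jr]; apply: H; rewrite inE ?eqxx // jr orbT.
Qed.

Lemma fo_sat_bigOr L (M : structure L) n (I : eqType) (r : seq I) (F : I -> fo L n)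
    (s : n.-tuple M) :
  fo_sat (\big[@FOr L n/FBot]_(i <- r) F i) s <->
  exists2 i, i \in r & fo_sat (F i) s.
Proof.
elim: r => [|i r IH]; first by rewrite big_nil; split=> [/(_ Logic.I)|[]].
rewrite big_cons /= IH; split=> [[Hi|[j jr Hj]]|[j]].
- by exists i; rewrite ?inE ?eqxx.
- by exists j; rewrite // inE jr orbT.
- by rewrite inE => /orP[/eqP->|jr]; [left|right; exists j].
Qed.

Section USemantics.
Variables (L : signature) (M : structure L).

Lemma fo_true_exs m (phi : fo L m) :
  fo_true M (fo_exs phi) <-> exists s : m.-tuple M, fo_sat phi s.
Proof.
elim: m phi => [|m IH] phi.
  by split=> [?|[s]]; [exists [tuple] | rewrite (tuple0 s)].
rewrite [fo_exs _]/(fo_exs (FEx phi)) IH.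
split=> [[s [x xs]]|[t]]; first by exists [tuple of x :: s].
by have [x [s ->]] := tuple_consE t; exists s, x.
Qed.

Lemma fo_sat_alls m j (phi : fo L (j + m)) (s : m.-tuple M) :
  fo_sat (fo_alls phi) s <-> forall y : j.-tuple M, fo_sat phi (cat_tuple y s).
Proof.
elim: j phi => [|j IH] phi.
  split=> [? y|/(_ [tuple])]; by rewrite cat_tuple0.
rewrite [fo_alls _]/(fo_alls (FAll phi)) IH.
split=> H y; last by move=> x; rewrite -cat_tuple_cons; exact: H.
by have [x [t ->]] := tuple_consE y; rewrite cat_tuple_cons; exact: H.
Qed.

End USemantics.

Lemma fo_true_U_form k m (eta : seq (literal (rel_sig k) m))
    (theta : fo (rel_sig k) (k + m)) (A : Type) (R : set (k.-tuple A)) :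
  fo_true (rel_structure R) (U_form eta theta) <->
  exists a : m.-tuple A,
    fo_sat (M := rel_structure R) (\big[@FAnd _ m/FTop]_(l <- eta) FLit l) a /\
    forall y, R y -> fo_sat (M := rel_structure R) theta (cat_tuple y a).
Proof.
have notE (y : k.-tuple A) (a : m.-tuple A) :
    fo_sat (M := rel_structure R) (not_R k m) (cat_tuple y a) <-> ~ R y.
  rewrite /= /lit_sat /=; set y' := map_tuple _ _; suff -> : y' = y by [].
  by apply: eq_from_tnth => i; rewrite tnth_map tnth_mktuple /= tnth_lshift.
rewrite fo_true_exs.
split=> -[a] /= [aeta H]; exists a; split=> //.
- move: H => /fo_sat_alls H y Ry; have [/notE|//] := H y; by [].
- apply/fo_sat_alls => y; have [Ry|nRy] := pselect (R y).
    by right; exact: H.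
  by left; exact/notE.
Qed.

(** * Ultraproducts *)

Section UltraFilterFacts.
Variables (I : Type) (U : set_system I).
Context {UU : UltraFilter U}.

Lemma ultraC (P : set I) : U (~` P) <-> ~ U P.
Proof.
split=> [nP P'|nP]; last by have [] := in_ultra_setVsetC P UU.
by have /filter_ex[i []] : U (P `&` ~` P) by exact: filterI.
Qed.

Lemma ultraU (P Q : set I) : U (P `|` Q) <-> U P \/ U Q.
Proof.
split=> [PQ|[]]; [|by apply: filterS => i; left|by apply: filterS => i; right].
have [?|/ultraC nP] := pselect (U P); first by left.
by right; apply: filterS (filterI PQ nP) => i [[]].
Qed.

Lemma ultraI (P Q : set I) : U (P `&` Q) <-> U P /\ U Q.
Proof.
split=> [PQ|[]]; last exact: filterI.
by split; apply: filterS PQ => i [].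
Qed.

(** Here [P] does not depend on the index. Finitely many equalities in an ultraproduct, true or
    false, can thus be reflected at a single index. *)
Lemma ultra_iff (P : Prop) (Q : set I) :
  (P <-> U Q) <-> U [set i | P <-> Q i].
Proof.
split=> PQ.
  have [p|np] := pselect P.
    by move/PQ : (p); apply: filterS => i Qi; split.
  have /ultraC : ~ U Q by move/PQ.
  by apply: filterS => i nQi; split.
split=> [p|Qi]; first by apply: filterS PQ => i [+ _]; exact.
by have /(filter_ex (F := U))[i [[_ +]]] : U ([set i | P <-> Q i] `&` Q);
  [exact: filterI | exact].
Qed.

End UltraFilterFacts.

(** The sets of lists containing a given finite list are nonempty and closed under intersection up
    to refinement, hence lie in an ultrafilter. *)
Lemma ultrafilter_seq (T : eqType) :
  exists2 U : set_system (seq T), UltraFilter U & forall c, U [set l : seq T | c \in l].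
Proof.
pose F := filter_from setT (fun l0 : seq T => [set l : seq T | {subset l0 <= l}]).
have FF : ProperFilter F.
  apply: filter_from_proper; last by move=> l _; exists l.
  apply: filter_fromT_filter; first by exists [::].
  move=> l1 l2; exists (l1 ++ l2) => l H.
  by split=> c cl; apply: H; rewrite mem_cat cl // orbT.
have [U [UU FU]] := ultraFilterLemma FF; exists U => // c; apply: FU.
by exists [:: c] => // l; apply; exact: mem_head.
Qed.

Section Ultraproduct.
Variables (I : Type) (U : set_system I) (M : I -> Type).
Context {UU : UltraFilter U}.

Definition ueq (f g : forall i, M i) : Prop := U [set i | f i = g i].

(** A point is an equivalence class given by its characteristic predicate, so equality of points is
    plain equality. *)
Definition ultraproduct : Type := {c | exists f, c = ueq f}.

Definition ucls (f : forall i, M i) : ultraproduct :=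
  exist _ (ueq f) (ex_intro _ f erefl).

Definition urepr (x : ultraproduct) : forall i, M i := sval (cid (svalP x)).

Lemma ureprK : cancel urepr ucls.
Proof.
by move=> x; apply: sval_inj; rewrite /= /urepr; case: cid.
Qed.

Lemma ucls_eq f g : ucls f = ucls g <-> U [set i | f i = g i].
Proof.
split=> [/(congr1 sval)/= fg|fg].
  have : ueq g g by apply: filterS filterT => i.
  by rewrite -fg.
have fgE : ueq f = ueq g.
  apply/funext => h; apply/propext; split=> gh.
    by apply: filterS (filterI fg gh) => i /= [->].
  by apply: filterS (filterI fg gh) => i /= [->].
exact: sval_inj.
Qed.

Lemma urepr_ucls f : U [set i | urepr (ucls f) i = f i].
Proof. by apply/ucls_eq; rewrite ureprK. Qed.

Definition ultrarel k (R : forall i, set (k.-tuple (M i))) :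
    set (k.-tuple ultraproduct) :=
  [set t | U [set i | R i (map_tuple (urepr^~ i) t)]].

Definition at_index k (F : k.-tuple (forall i, M i)) i : k.-tuple (M i) :=
  map_tuple (fun f => f i) F.

Lemma ultrarelE k R (F : k.-tuple (forall i, M i)) :
  ultrarel R (map_tuple ucls F) <-> U [set i | R i (at_index F i)].
Proof.
have H : U [set i | map_tuple (urepr^~ i) (map_tuple ucls F) = at_index F i].
  have : U [set i | forall j, urepr (ucls (tnth F j)) i = tnth F j i].
    by apply: filter_forall => j; exact: urepr_ucls.
  apply: filterS => i Fi; apply: eq_from_tnth => j.
  by rewrite !tnth_map.
by split=> RF; apply: filterS (filterI H RF) => i /= [->].
Qed.

Lemma ultraproduct_tupleE k (t : k.-tuple ultraproduct) :
  exists F, t = map_tuple ucls F.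
Proof.
exists (map_tuple urepr t); apply: eq_from_tnth => j.
by rewrite !tnth_map ureprK.
Qed.

End Ultraproduct.

Arguments ucls {I} U {M} f.
Arguments ultrarel {I} U {M k} R.

(** * The theorem of Los for signatures without function symbols *)

Section Los.
Variables (L : signature) (no_fsym : Defs.fsym L -> False).
Variables (I : Type) (U : set_system I) (M : I -> structure L).
Context {UU : UltraFilter U}.

Definition ultrastructure : structure L :=
  @Structure L (ultraproduct U M) (fun f _ => match no_fsym f with end)
    (fun r => ultrarel U (fun i => @rinterp L (M i) r)).

Lemma eval_ultra n (F : n.-tuple (forall i, M i)) (t : term L n) :
  eval (M := ultrastructure) (map_tuple (ucls U) F) t =
  ucls U (fun i => eval (at_index F i) t).
Proof.
case: t => [j|f]; last by have := no_fsym f.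
rewrite /= tnth_map; apply/ucls_eq; apply: filterS filterT => i _ /=.
by rewrite tnth_map.
Qed.

Lemma atom_sat_ultra n (F : n.-tuple (forall i, M i)) (a : atom L n) :
  atom_sat (M := ultrastructure) (map_tuple (ucls U) F) a <->
  U [set i | atom_sat (at_index F i) a].
Proof.
case: a => [|t u|r ts].
- by split=> // _; exact: filterT.
- by rewrite /= !eval_ultra ucls_eq.
- set G := map_tuple (fun t i => eval (at_index F i) t) ts.
  have GE : map_tuple (eval (M := ultrastructure) (map_tuple (ucls U) F)) ts =
      map_tuple (ucls U) G.
    by apply: eq_from_tnth => j; rewrite !tnth_map eval_ultra.
  rewrite /= GE ultrarelE.
  have GiE i : at_index G i = map_tuple (eval (at_index F i)) ts.
    by apply: eq_from_tnth => j; rewrite !tnth_map.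
  by split; apply: filterS => i /=; rewrite GiE.
Qed.

Lemma lit_sat_ultra n (F : n.-tuple (forall i, M i)) (l : literal L n) :
  lit_sat (M := ultrastructure) (map_tuple (ucls U) F) l <->
  U [set i | lit_sat (at_index F i) l].
Proof.
case: l => -[] a; rewrite /lit_sat /= atom_sat_ultra //.
by rewrite -ultraC.
Qed.

Lemma at_index_cons n f (F : n.-tuple (forall i, M i)) i :
  at_index [tuple of f :: F] i = [tuple of f i :: at_index F i].
Proof. exact: val_inj. Qed.

Lemma los n (phi : fo L n) (F : n.-tuple (forall i, M i)) :
  (forall i, inhabited (M i)) ->
  fo_sat (M := ultrastructure) phi (map_tuple (ucls U) F) <->
  U [set i | fo_sat phi (at_index F i)].
Proof.
move=> iM; have consE m f (G : m.-tuple (forall i, M i)) :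
    [tuple of ucls U f :: map_tuple (ucls U) G] = map_tuple (ucls U) [tuple of f :: G].
  exact: val_inj.
have witness m (G : m.-tuple (forall i, M i)) (P : forall i, set (m.+1.-tuple (M i))) :
    U [set i | exists x, P i [tuple of x :: at_index G i]] <->
    exists f, U [set i | P i (at_index [tuple of f :: G] i)].
  split=> [H|[f]]; last by apply: filterS => i; rewrite /= at_index_cons; exists (f i).
  (* Witnesses are chosen index by index; where none exists, an arbitrary element of the nonempty
     carrier is taken. *)
  have gP i : exists x, (exists y, P i [tuple of y :: at_index G i]) ->
      P i [tuple of x :: at_index G i].
    have [[x Px]|nP] := pselect (exists y, P i [tuple of y :: at_index G i]).
      by exists x.
    by have [x] := iM i; exists x.
  exists (fun i => sval (cid (gP i))); apply: filterS H => i /= Pi.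
  by rewrite at_index_cons; case: cid => /= x; exact.
elim: phi F => {n} [n l|n p IHp q IHq|n p IHp q IHq|n p IH|n p IH] F.
- exact: lit_sat_ultra.
- by rewrite /= IHp IHq -ultraI.
- by rewrite /= IHp IHq -ultraU.
- rewrite /= (witness _ F (fun i => fo_sat p)); split=> [[x]|[f]].
    by rewrite -(ureprK x) consE IH => ?; exists (urepr x).
  by rewrite -IH -consE; exists (ucls U f).
(* Counterexamples at almost all indices would assemble, by [witness], into one counterexample in
   the ultraproduct. *)
- rewrite /= -[X in _ <-> X]notK -ultraC.
  split=> [H|H x].
    move=> nH; have : U [set i | exists x, ~ fo_sat p [tuple of x :: at_index F i]].
      by apply: filterS nH => i /= /existsNP.
    move=> /(witness _ F (fun i t => ~ fo_sat p t)) [f /ultraC]; apply.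
    by apply/IH; rewrite -consE; exact: H.
  rewrite -(ureprK x) consE IH; apply: contrapT => /(ultraC (U := U) _).2 nH; apply: H.
  apply: filterS nH => i /=; rewrite at_index_cons => nH all; exact/nH/all.
Qed.

End Los.

(** * Alternating chains *)

Section RelUltraproduct.
Variables (I : Type) (U : set_system I) (M : I -> Type).
Context {UU : UltraFilter U}.
Hypothesis inhM : forall i, inhabited (M i).

Lemma fo_true_ultrarel k (R : forall i, set (k.-tuple (M i)))
    (phi : fo (rel_sig k) 0) :
  fo_true (rel_structure (ultrarel U R)) phi <->
  U [set i | fo_true (rel_structure (R i)) phi].
Proof.
pose nof (f : Defs.fsym (rel_sig k)) : False := match f with end.
have -> : rel_structure (ultrarel U R) =
    ultrastructure nof U (fun i => rel_structure (R i)).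
  by congr Structure; apply: functional_extensionality_dep => -[].
have := los nof (U := U) (M := fun i => rel_structure (R i)) phi [tuple] inhM.
set t := map_tuple _ _; rewrite /fo_true (_ : [tuple] = t); last exact: val_inj.
move=> ->; split; apply: filterS => i /=.
  by set s := at_index _ _; rewrite (_ : [tuple] = s) //; exact: val_inj.
by set s := at_index _ _; rewrite (_ : [tuple] = s) //; exact: val_inj.
Qed.

(** A strongly first order dependency is defined by a first order sentence, to which the theorem of
    Los applies. *)
Lemma dep_ultrarel k (D : dependency k) (R : forall i, set (k.-tuple (M i))) :
  strongly_first_order D ->
  D _ (ultrarel U R) <-> U [set i | D _ (R i)].
Proof.
move=> /strongly_first_order_definable [delta deltaP].
have iU : inhabited (ultraproduct U M).
  have f i : M i by apply: inhabited_witness.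
  by constructor; exact: ucls.
rewrite (deltaP _ _ iU) fo_true_ultrarel.
by split; apply: filterS => i; rewrite /= deltaP.
Qed.

End RelUltraproduct.

(** * Families of relations indexed by the carrier, and their unions *)

Section Family.
Variable k : nat.

Definition family_rel (A : Type) (G : A -> set (k.-tuple A)) : set ((k + 1).-tuple A) :=
  [set t | G (tnth t (rshift k ord0)) [tuple tnth t (lshift 1 i) | i < k]].

Lemma family_relE A (G : A -> set (k.-tuple A)) y x :
  family_rel G (cat_tuple y [tuple x]) = G x y.
Proof.
rewrite /family_rel /= tnth_rshift; congr (G _ _).
by apply: eq_from_tnth => i; rewrite tnth_mktuple tnth_lshift.
Qed.

(** Lets an ultraproduct of coded families be read as a coded family again. *)
Lemma family_rel_sections A (T : set ((k + 1).-tuple A)) :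
  family_rel (fun x => [set y | T (cat_tuple y [tuple x])]) = T.
Proof.
apply/funext => t; rewrite /family_rel /=; congr T.
apply: eq_from_tnth => i; case: (split_ordP i) => j ->.
  by rewrite tnth_lshift tnth_mktuple.
by rewrite tnth_rshift (ord1 j) (tnth_nth (tnth t (rshift k ord0))).
Qed.

Lemma ultrarel_family_relE I (U : set_system I) (M : I -> Type)
    {UU : UltraFilter U} (G : forall i, M i -> set (k.-tuple (M i)))
    (F : k.-tuple (forall i, M i)) (f : forall i, M i) :
  ultrarel U (fun i => family_rel (G i))
    (cat_tuple (map_tuple (ucls U) F) [tuple ucls U f]) <->
  U [set i | G i (f i) (at_index F i)].
Proof.
have -> : cat_tuple (map_tuple (ucls U) F) [tuple ucls U f] =
    map_tuple (ucls U) (cat_tuple F [tuple f]).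
  by rewrite map_cat_tuple; congr cat_tuple; apply: val_inj.
rewrite ultrarelE.
have E i : at_index (cat_tuple F [tuple f]) i = cat_tuple (at_index F i) [tuple f i].
  by rewrite /at_index map_cat_tuple; congr cat_tuple; apply: val_inj.
by split; apply: filterS => i /=; rewrite E family_relE.
Qed.

(** The existential may assign any nonempty set of indices; the guard then applies the dependency to
    the union of the corresponding sections. *)
Definition some_union : team_fo (rel_sig (k + 1)) k 0 :=
  TEx (team_guard (k := k) (m := 1)
    (@ARel (rel_sig (k + 1)) _ tt [tuple Var _ i | i < k + 1])).

Lemma team_true_some_union (D : dependency k) A (G : A -> set (k.-tuple A)) :
  team_true D (rel_structure (family_rel G)) some_union <->
  exists2 X : set A, X !=set0 & D A (\bigcup_(x in X) G x).
Proof.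
have atomE y x : atom_sat (M := rel_structure (family_rel G))
    (cat_tuple y [tuple x])
    (@ARel (rel_sig (k + 1)) _ tt [tuple Var _ i | i < k + 1]) = G x y.
  rewrite /= -family_relE; congr family_rel.
  by apply: eq_from_tnth => i; rewrite tnth_map tnth_mktuple.
have bigcupE (H : 0.-tuple A -> set A) :
    [set y | exists2 s : 1.-tuple A,
      team_supplement (M := rel_structure (family_rel G)) [set [tuple]] H s &
      atom_sat (M := rel_structure (family_rel G)) (cat_tuple y s)
        (@ARel (rel_sig (k + 1)) _ tt [tuple Var _ i | i < k + 1])] =
    \bigcup_(x in H [tuple]) G x.
  apply/seteqP; split=> [y [_ [s [x [-> Hx ->]]]]|y [x Hx Gxy]].
    rewrite (_ : [tuple of _ :: _] = [tuple x]); last exact: val_inj.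
    by rewrite atomE; exists x.
  exists [tuple x]; rewrite ?atomE //.
  by exists [tuple], x; split=> //; exact: val_inj.
rewrite /team_true /=; split=> [[H [H0 /team_sat_guard DH]]|[X X0 DX]].
  by exists (H [tuple]); [exact: H0|rewrite -bigcupE].
by exists (fun=> X); split=> //; apply/team_sat_guard; rewrite bigcupE.
Qed.

End Family.

(** Only indices up to [n] are constrained; the sequences are arbitrary beyond. *)
Definition dep_chain k (D : dependency k) n (C : Type)
    (R S : nat -> set (k.-tuple C)) : Prop :=
  (forall i, i <= n -> [/\ D C (R i), ~ D C (S i) & R i `<=` S i]) /\
  (forall i, i < n -> S i `<=` R i.+1).

Lemma no_long_dep_chains k (D : dependency k) :
  domain_independent D -> union_closed D -> strongly_first_order D ->
  ~ (forall n, exists (C : Type) (R S : nat -> set (k.-tuple C)), dep_chain D n R S).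
Proof.
move=> D_di D_uc D_sfo chains.
have chain n : {c : {C : Type & ((nat -> set (k.-tuple C)) *
    (nat -> set (k.-tuple C)))%type} | dep_chain D n (projT2 c).1 (projT2 c).2}.
  by apply: cid; have [C [R [S RS]]] := chains n; exists (existT _ C (R, S)).
pose C n := projT1 (sval (chain n)).
pose R n : nat -> set (k.-tuple (C n)) := (projT2 (sval (chain n))).1.
pose S n : nat -> set (k.-tuple (C n)) := (projT2 (sval (chain n))).2.
have cP n : dep_chain D n (R n) (S n) := svalP (chain n).
have S_homo n i j : i <= j -> j <= n -> S n i `<=` S n j.
  have [RS SR] := cP n.
  move=> ij; rewrite -(subnK ij); elim: (j - i) => [|d IH] dn; first exact: subset_refl.
  apply: subset_trans (IH (ltnW dn)) _; apply: subset_trans (SR _ dn) _.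
  by have [] := RS _ dn.
have [psi psiP] := D_sfo _ (some_union k).
have [U UU Ucone] := ultrafilter_seq nat.
(* Each standard number belongs to almost all lists, so the chain lengths [N l] eventually exceed
   it. *)
pose N (l : seq nat) := \max_(i <- l) i.
(* The natural numbers are adjoined as new points, to serve as indices of the family; domain
   independence makes this harmless. *)
pose M l := (nat + C (N l))%type.
pose lift l (Q : set (k.-tuple (C (N l)))) : set (k.-tuple (M l)) := map_tuple inr @` Q.
(* Truncation at [N l] and the default 0 make every point the index of a genuine member of the
   chain. *)
pose idx l (x : M l) : nat := if x is inl i then minn i (N l) else 0.
pose G l (x : M l) : set (k.-tuple (M l)) := lift l (S (N l) (idx l x)).
have liftD l Q : D _ (lift l Q) <-> D _ Q by rewrite -dep_inj // => x y [].
have iM l : inhabited (M l) by constructor; exact: (inl 0).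
have idxN l x : idx l x <= N l by case: x => [i|//]; exact: geq_minr.
(* The indices occurring in a nonempty [X] are bounded, and the union over [X] is the member with
   the largest one, which is outside [D]. *)
have psiF l : ~ fo_true (rel_structure (family_rel (G l))) psi.
  rewrite -(psiP (rel_structure (family_rel (G l))) (iM l)).
  move=> /team_true_some_union[X [x0 Xx0]].
  pose P := [pred j | `[<exists2 x, X x & idx l x = j>]].
  have exP : exists j, P j by exists (idx l x0); apply/asboolP; exists x0.
  have ubP j : P j -> j <= N l by move=> /asboolP[x _ <-].
  have [j /asboolP[x Xx xj] jmax] := ex_maxnP exP ubP.
  suff -> : \bigcup_(x in X) G l x = lift l (S (N l) j).
    move=> /liftD; have [/(_ j) RS _] := cP (N l).
    by have [|//] := RS; rewrite -xj.
  apply/seteqP; split=> [y [x' Xx' [z Sz <-]]|y Gy]; last by exists x; rewrite // /G xj.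
  exists z => //; apply: S_homo Sz; last by rewrite -xj.
  by apply: jmax; apply/asboolP; exists x'.
have : ~ fo_true (rel_structure (ultrarel U (fun l => family_rel (G l)))) psi.
  rewrite fo_true_ultrarel // => /filter_ex [l]; exact: psiF.
rewrite -(family_rel_sections (ultrarel U _)); set Gu := (fun x => _).
have iu : inhabited (ultraproduct U M) by constructor; exact: (ucls U (fun l => inl 0)).
rewrite -(psiP (rel_structure (family_rel Gu)) iu); apply.
apply/team_true_some_union.
(* The standard indices, which have no largest element. *)
pose X := range (fun i : nat => ucls U (fun l => inl i : M l)).
exists X; first by exists (ucls U (fun l => inl 0)), 0.
pose Rc i := ultrarel U (fun l => lift l (R (N l) (minn i (N l)))).
suff -> : \bigcup_(x in X) Gu x = \bigcup_i Rc i.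
  apply: D_uc => i; apply/dep_ultrarel => //.
  apply: filterS filterT => l _ /=; apply/liftD.
  by have [/(_ _ (geq_minr i (N l)))[]] := cP (N l).
apply/seteqP; split=> y; have [F ->] := ultraproduct_tupleE y.
  move=> [_ [i _ <-]]; rewrite /Gu /= ultrarel_family_relE => GF.
  (* Each standard S_i lies in R_(i+1): almost every list contains [i.+1], so that [i < N l] and
     truncation changes neither index. *)
  exists i.+1 => //; apply/ultrarelE.
  apply: filterS (filterI GF (Ucone i.+1)) => l [[z Sz zF] li].
  have iN : i < N l by exact: (leq_bigmax_seq (F := id) _ li).
  exists z; last exact: zF.
  move: Sz; rewrite /= (minn_idPl iN) (minn_idPl (ltnW iN)).
  by have [_] := cP (N l); apply.
move=> [i _ /ultrarelE RF]; exists (ucls U (fun l => inl i)); first by exists i.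
rewrite /Gu /= ultrarel_family_relE; apply: filterS RF => l [z Rz zF].
exists z; last exact: zF.
have [/(_ _ (geq_minr i (N l)))[_ _ RS] _] := cP (N l); exact: RS.
Qed.

(** * Equality patterns and undetected relations *)

(** The equality type of a tuple, as a Boolean matrix: types over different carriers can be
    compared, and there are finitely many for each length. *)
Definition eqpat (A : Type) n (z : n.-tuple A) : {ffun 'I_n * 'I_n -> bool} :=
  [ffun p => `[<tnth z p.1 = tnth z p.2>]].

Lemma eqpat_eqP (A B : Type) n (z : n.-tuple A) (w : n.-tuple B) :
  eqpat z = eqpat w <->
  forall i j, tnth z i = tnth z j <-> tnth w i = tnth w j.
Proof.
split=> [zw i j|zw]; last first.
  by apply/ffunP => -[i j]; rewrite !ffunE; apply/asbool_equiv_eq/zw.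
have := congr1 (fun t : {ffun 'I_n * 'I_n -> bool} => t (i, j)) zw.
by rewrite !ffunE /= => E; split=> /asboolP; [rewrite E|rewrite -E] => /asboolP.
Qed.

Section PatternFormulas.
Variables (L : signature) (n : nat).
Implicit Type tau : {ffun 'I_n * 'I_n -> bool}.

Definition pat_literal tau (p : 'I_n * 'I_n) : literal L n :=
  Literal (tau p) (AEq (Var L p.1) (Var L p.2)).

Definition pat_literals tau : seq (literal L n) :=
  [seq pat_literal tau p | p <- enum {: 'I_n * 'I_n}].

Definition pat_fo tau : fo L n :=
  \big[@FAnd L n/FTop]_(l <- pat_literals tau) FLit l.

Lemma fo_sat_pat (M : structure L) tau (s : n.-tuple M) :
  fo_sat (pat_fo tau) s <-> eqpat s = tau.
Proof.
rewrite /pat_fo big_map fo_sat_bigAnd; split=> [H|<- p _]; last first.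
  by rewrite /= /lit_sat /= ffunE; case: asboolP.
apply/ffunP => p; rewrite ffunE; have /= := H p (mem_enum _ p).
by rewrite /lit_sat /=; case: (tau p) => ?; [exact/asboolP|exact/asboolPn].
Qed.

Lemma rel_free_pat tau : rel_free (pat_fo tau).
Proof.
by rewrite /pat_fo big_map; apply: (big_ind (fun phi => rel_free phi)) => //= p q -> ->.
Qed.

End PatternFormulas.

(* The strongest U-sentence, up to the size of the domain, that [R] satisfies
   with witnesses [a]. *)
Lemma U_description k m (A : Type) (R : set (k.-tuple A)) (a : m.-tuple A) :
  exists2 chi : fo (rel_sig k) 0, U_sentence chi &
  forall (B : Type) (S : set (k.-tuple B)), fo_true (rel_structure S) chi <->
    exists b : m.-tuple B, [/\ eqpat b = eqpat a,
      forall t, R (map_tuple (tnth a) t) -> S (map_tuple (tnth b) t) &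
      forall s, S s -> exists2 r, R r & eqpat (cat_tuple s b) = eqpat (cat_tuple r a)].
Proof.
pose Rlit (t : k.-tuple 'I_m) : literal (rel_sig k) m :=
  Literal true (@ARel (rel_sig k) m tt (map_tuple (@Var _ _) t)).
pose ts := [seq t <- enum {: k.-tuple 'I_m} | `[<R (map_tuple (tnth a) t)>]].
pose eta := pat_literals _ (eqpat a) ++
  [seq Rlit t | t <- ts].
(* [R] may be infinite, but its tuples realise finitely many types over [a], so their disjunction is
   a formula. *)
pose taus := [seq tau <- enum {: {ffun 'I_(k + m) * 'I_(k + m) -> bool}} |
  `[<exists2 r, R r & eqpat (cat_tuple r a) = tau>]].
pose theta := \big[@FOr _ _/FBot]_(tau <- taus) pat_fo (rel_sig k) tau.
exists (U_form eta theta).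
  exists m, eta, theta; split=> //.
    by rewrite all_cat !all_map; apply/andP; split; apply/allP.
  apply: (big_ind (fun phi => rel_free phi)) => //= [p q -> ->//|tau _].
  exact: rel_free_pat.
move=> B S; rewrite fo_true_U_form.
have etaP (b : m.-tuple B) : fo_sat (M := rel_structure S)
      (\big[@FAnd _ m/FTop]_(l <- eta) FLit l) b <->
    eqpat b = eqpat a /\
    forall t, R (map_tuple (tnth a) t) -> S (map_tuple (tnth b) t).
  have catE (r1 r2 : seq (literal (rel_sig k) m)) : fo_sat (M := rel_structure S)
        (\big[@FAnd _ m/FTop]_(l <- r1 ++ r2) FLit l) b <->
      fo_sat (M := rel_structure S) (\big[@FAnd _ m/FTop]_(l <- r1) FLit l) b /\
      fo_sat (M := rel_structure S) (\big[@FAnd _ m/FTop]_(l <- r2) FLit l) b.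
    elim: r1 => [|l r IH]; first by rewrite big_nil; split=> [|[]].
    by rewrite !big_cons /= IH; tauto.
  have bE t : map_tuple (eval (M := rel_structure S) b) (map_tuple (@Var _ _) t) =
      map_tuple (tnth b) t by apply: eq_from_tnth => i; rewrite !tnth_map.
  have := fo_sat_pat (M := rel_structure S) (eqpat a) b; rewrite /pat_fo => patE.
  rewrite catE big_map patE fo_sat_bigAnd.
  split=> -[ba H]; split=> // t Rt.
    have := H t; rewrite /= /lit_sat /= bE; apply.
    by rewrite mem_filter mem_enum andbT; exact/asboolP.
  rewrite /= /lit_sat /= bE; apply: H.
  by move: Rt; rewrite mem_filter => /andP[/asboolP].
have thetaP (b : m.-tuple B) s : fo_sat (M := rel_structure S) theta (cat_tuple s b) <->
    exists2 r, R r & eqpat (cat_tuple s b) = eqpat (cat_tuple r a).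
  rewrite fo_sat_bigOr; split=> [[tau]|[r Rr sr]].
    rewrite mem_filter => /andP[/asboolP[r Rr <-] _] /fo_sat_pat; by exists r.
  exists (eqpat (cat_tuple r a)); last exact/fo_sat_pat.
  by rewrite mem_filter mem_enum andbT; apply/asboolP; exists r.
split=> -[b].
  move=> [/etaP[ba bR] H]; exists b; split=> // s Ss; exact/thetaP/H.
by move=> [ba bR H]; exists b; split=> [|s Ss]; [exact/etaP|exact/thetaP/H].
Qed.

Definition U_implies_dep k (D : dependency k) (chi : fo (rel_sig k) 0) : Prop :=
  U_sentence chi /\
  forall (B : Type) (S : set (k.-tuple B)), fo_true (rel_structure S) chi -> D B S.

Definition U_undetected k (D : dependency k) (A : Type) (R : set (k.-tuple A)) : Prop :=
  [/\ inhabited A, D A R &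
    forall chi, U_implies_dep D chi -> ~ fo_true (rel_structure R) chi].

(** * Chains built from undetected relations, and compactness *)

Section Step.
Variables (k : nat) (D : dependency k).
Hypothesis D_di : domain_independent D.
Hypothesis D_uc : union_closed D.
Hypothesis D_sfo : strongly_first_order D.

Lemma U_undetected_limit_point (A : eqType) (R : set (k.-tuple A)) :
  U_undetected D R ->
  exists (B : Type) (f : A -> B) (s : k.-tuple B),
    [/\ injective f, ~ D B (map_tuple f @` R `|` [set s]) &
      forall l : seq A, exists r, [/\ R r,
        forall i j, tnth s i = tnth s j <-> tnth r i = tnth r j &
        forall i x, x \in l -> (tnth s i = f x <-> tnth r i = x)]].
Proof.
move=> [[x0] DR RU].
(* The extra entry [x0] keeps the tuple nonempty: [pos] is total, and the countermodels below are
   inhabited. *)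
pose a (l : seq A) : (size l).+1.-tuple A := in_tuple (x0 :: l).
pose pos (l : seq A) (x : A) : 'I_(size l).+1 := inord (index x (x0 :: l)).
have posK l x : x \in l -> tnth (a l) (pos l x) = x.
  move=> xl; have xl' : x \in x0 :: l by rewrite inE xl orbT.
  rewrite (tnth_nth x0) inordK ?nth_index //.
  by rewrite -[ltnRHS]/(size (x0 :: l)) index_mem.
have counter l : {d : {B : Type & (set (k.-tuple B) * (size l).+1.-tuple B)%type} |
    [/\ ~ D _ (projT2 d).1, eqpat (projT2 d).2 = eqpat (a l),
      forall t, R (map_tuple (tnth (a l)) t) ->
        (projT2 d).1 (map_tuple (tnth (projT2 d).2) t) &
      forall s, (projT2 d).1 s ->
        exists2 r, R r & eqpat (cat_tuple s (projT2 d).2) = eqpat (cat_tuple r (a l))]}.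
  (* The description holds in [R]; if all its models were in [D], it would detect [R]. *)
  apply: cid; have [chi Uchi chiP] := U_description R (a l).
  apply: contrapT => nex; apply: (RU chi); last first.
    by apply/chiP; exists (a l); split=> // r Rr; exists r.
  split=> // B S /chiP[b [ba bR Sb]]; apply: contrapT => nDS; apply: nex.
  by exists (existT _ B (S, b)).
pose B l := projT1 (sval (counter l)).
pose S l : set (k.-tuple (B l)) := (projT2 (sval (counter l))).1.
pose b l : (size l).+1.-tuple (B l) := (projT2 (sval (counter l))).2.
have nDS l : ~ D _ (S l) by have [] := svalP (counter l).
have ba l i j : tnth (b l) i = tnth (b l) j <-> tnth (a l) i = tnth (a l) j.
  by move: i j; apply/eqpat_eqP; have [] := svalP (counter l).
have bR l t : R (map_tuple (tnth (a l)) t) -> S l (map_tuple (tnth (b l)) t).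
  by have [_ _ + _] := svalP (counter l); exact.
have Sb l s : S l s -> exists2 r, R r &
    eqpat (cat_tuple s (b l)) = eqpat (cat_tuple r (a l)).
  by have [_ _ _] := svalP (counter l); exact.
have [U UU Ucone] := ultrafilter_seq A.
have UI P Q : U P -> U Q -> U (P `&` Q) by exact: filterI.
(* The copy of [x] in the countermodel for [l], meaningful once [x] occurs in [l]. *)
pose g (x : A) l := tnth (b l) (pos l x).
pose f (x : A) : ultraproduct U B := ucls U (g x).
have fI : injective f.
  move=> x y /ucls_eq fxy.
  have /(filter_ex (F := U))[l [[gxy xl] yl]] := UI _ _ (UI _ _ fxy (Ucone x)) (Ucone y).
  by move/ba: gxy; rewrite !posK.
pose Su := ultrarel U S.
have fRS : map_tuple f @` R `<=` Su.
  move=> _ [r Rr <-].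
  have -> : map_tuple f r = map_tuple (ucls U) (map_tuple g r).
    by apply: eq_from_tnth => i; rewrite !tnth_map.
  apply/ultrarelE.
  have : U [set l : seq A | forall i, tnth r i \in l].
    by apply: filter_forall => i; exact: Ucone.
  apply: filterS => l rl.
  have E : map_tuple (tnth (b l)) (map_tuple (pos l) r) = at_index (map_tuple g r) l.
    by apply: eq_from_tnth => i; rewrite !tnth_map.
  rewrite /mkset -E.
  apply: bR; set r' := map_tuple _ _; suff -> : r' = r by [].
  by apply: eq_from_tnth => i; rewrite !tnth_map posK.
have nDSu : ~ D _ Su.
  rewrite dep_ultrarel // => [|l]; last by constructor; exact: (tnth (b l) ord0).
  by move=> /filter_ex[l]; exact: nDS.
(* Otherwise [Su], being the union of the copy of [R] and of its one-tuple extensions inside [Su],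
   would be in [D]. *)
have [s Ss nDs] : exists2 s, Su s & ~ D _ (map_tuple f @` R `|` [set s]).
  apply: contrapT => nex; apply: nDSu.
  have -> : Su = (map_tuple f @` R) `|`
      \bigcup_(s : {s | Su s}) (map_tuple f @` R `|` [set sval s]).
    apply/seteqP; split=> [s Ss|s [/fRS//|[[s' Ss'] _ [/fRS//|->//]]]].
    by right; exists (exist _ s Ss) => //; right.
  apply: union_closed_setU => //; first by apply/(dep_inj D_di _ fI).
  apply: D_uc => -[s Ss]; apply: contrapT => nDs; apply: nex; by exists s.
exists (ultraproduct U B), f, s; split=> // l0.
have [F sF] := ultraproduct_tupleE s; rewrite {}sF in Ss nDs *.
move/ultrarelE: Ss => SF.
have Fij : U [set l | forall ij : 'I_k * 'I_k,
    tnth (map_tuple (ucls U) F) ij.1 = tnth (map_tuple (ucls U) F) ij.2 <->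
    tnth F ij.1 l = tnth F ij.2 l].
  by apply: filter_forall => ij; apply/ultra_iff; rewrite !tnth_map ucls_eq.
have Fix_ : U [set l | forall iy : 'I_k * 'I_(size l0),
    tnth (map_tuple (ucls U) F) iy.1 = f (tnth (in_tuple l0) iy.2) <->
    tnth F iy.1 l = g (tnth (in_tuple l0) iy.2) l].
  by apply: filter_forall => iy; apply/ultra_iff; rewrite !tnth_map ucls_eq.
have l0l : U [set l | forall y : 'I_(size l0), tnth (in_tuple l0) y \in l].
  by apply: filter_forall => y; exact: Ucone.
(* At one index [l] the tuple [F] has the type of [s] over [l0]; being in [S l] there, it shares its
   type with some tuple of [R]. *)
have /(filter_ex (F := U))[l [[Sl ijl] [ixl {}l0l]]] :=
  UI _ _ (UI _ _ SF Fij) (UI _ _ Fix_ l0l).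
have [r Rr /eqpat_eqP rs] := Sb _ _ Sl.
exists r; split=> // [i j|i x /(tnthP (in_tuple l0))[y ->]].
  rewrite (ijl (i, j)) /=.
  by have := rs (lshift _ i) (lshift _ j); rewrite !tnth_lshift !tnth_map.
rewrite (ixl (i, y)) /=.
have := rs (lshift _ i) (rshift _ (pos l (tnth (in_tuple l0) y))).
by rewrite !tnth_lshift !tnth_rshift !tnth_map posK.
Qed.

(** The tuples of [R] approximating [s] over finite lists define one tuple [q] of the ultrapower,
    with the equality type of [s] over all of [A]. Adding [q] or [s] to [R] therefore gives
    relations that [D] cannot distinguish, and the ultrapower stays undetected because it satisfies
    the same sentences as [R]. *)
Lemma U_undetected_step (A : Type) (R : set (k.-tuple A)) :
  U_undetected D R ->
  exists (A' : Type) (d : A -> A') (R' S : set (k.-tuple A')),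
    [/\ U_undetected D R', injective d, map_tuple d @` R `<=` S,
      S `<=` R' & ~ D A' S].
Proof.
move=> RU.
have [B [f [s [fI nDs]]]] := @U_undetected_limit_point {classic A} R RU.
move=> /boolp.choice[r rP].
have [U UU Ucone] := ultrafilter_seq {classic A}.
have [iA DR RnU] := RU.
pose d (x : A) := ucls U (fun=> x : A).
pose q i := ucls U (fun l => tnth (r l) i : A).
have dI : injective d by move=> x y /ucls_eq /filter_ex[].
exists (ultraproduct U (fun=> A)), d, (ultrarel U (fun=> R)),
  (map_tuple d @` R `|` [set [tuple q i | i < k]]).
split=> //.
- split=> [||chi Dchi].
  + by have [x] := iA; constructor; exact: d x.
  + by apply/dep_ultrarel => //; apply: filterS filterT.
  + by rewrite fo_true_ultrarel // => /filter_ex[l]; exact: RnU.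
- move=> t [[u Ru <-]|->].
    have -> : map_tuple d u =
        map_tuple (ucls U) (map_tuple (fun x (_ : seq {classic A}) => x) u).
      by apply: eq_from_tnth => i; rewrite !tnth_map.
    apply/ultrarelE; apply: filterS filterT => l _.
    rewrite /mkset; set u' := at_index _ _; suff -> : u' = u by [].
    by apply: eq_from_tnth => i; rewrite !tnth_map.
  have -> : [tuple q i | i < k] =
      map_tuple (ucls U) [tuple (fun l => tnth (r l) i : A) | i < k].
    by apply: eq_from_tnth => i; rewrite !(tnth_map, tnth_mktuple).
  apply/ultrarelE; apply: filterS filterT => l _.
  rewrite /mkset; set u' := at_index _ _; suff -> : u' = r l by have [] := rP l.
  by apply: eq_from_tnth => i; rewrite !(tnth_map, tnth_mktuple).
(* The points of [A] and the positions of the added tuple are common names for the two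
   extensions. *)
- pose u (z : A + 'I_k) := match z with inl x => f x | inr i => tnth s i end.
  pose v (z : A + 'I_k) := match z with inl x => d x | inr i => q i end.
  pose W : set (k.-tuple (A + 'I_k)) :=
    map_tuple inl @` R `|` [set [tuple inr i | i < k]].
  have uW : map_tuple u @` W = map_tuple f @` R `|` [set s].
    rewrite image_setU image_set1 image_comp; congr (_ `|` [set _]).
      by apply: eq_imagel => t _; apply: eq_from_tnth => i; rewrite !tnth_map.
    by apply: eq_from_tnth => i; rewrite !(tnth_map, tnth_mktuple).
  have vW : map_tuple v @` W = map_tuple d @` R `|` [set [tuple q i | i < k]].
    rewrite image_setU image_set1 image_comp; congr (_ `|` [set _]).
      by apply: eq_imagel => t _; apply: eq_from_tnth => i; rewrite !tnth_map.
    by apply: eq_from_tnth => i; rewrite !(tnth_map, tnth_mktuple).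
  rewrite -uW in nDs; rewrite -vW => DW; apply: nDs; apply: dep_eqker DW => //.
  have xi x i : f x = tnth s i <-> d x = q i.
    rewrite ucls_eq; apply/ultra_iff.
    (* Any list containing [x] decides whether [x] is the entry at [i] as [s] does. *)
    apply: filterS (Ucone x) => l xl; have [_ _ /(_ i x xl) H] := rP l.
    by split=> [/esym/H|/esym/H].
  move=> [x|i] [y|j] /=.
  + by split=> [/dI|/fI] ->.
  + by rewrite xi.
  + by split=> /esym/xi/esym.
  + rewrite -[_ <-> _]/(q i = q j <-> tnth s i = tnth s j) ucls_eq.
    apply: iff_sym; apply/ultra_iff; apply: filterS filterT => l _.
    by have [_ /(_ i j)] := rP l.
Qed.

(** The chain grows at the bottom: one step gives [R'], and the induction hypothesis a chain
    starting at a copy of [R']. Recording the first member as the image of [R] is what allows this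
    gluing. *)
Lemma U_undetected_chain n (A : Type) (R : set (k.-tuple A)) :
  U_undetected D R ->
  exists (C : Type) (g : A -> C) (Rs Ss : nat -> set (k.-tuple C)),
    [/\ injective g, Rs 0 = map_tuple g @` R & dep_chain D n Rs Ss].
Proof.
elim: n A R => [|n IH] A R RU;
  have [A' [d [R' [S [RU' dI dRS SR' nDS]]]]] := U_undetected_step RU;
  have [_ DR _] := RU.
  exists A', d, (fun=> map_tuple d @` R), (fun=> S); split=> //.
  by split=> // i _; split=> //; apply/(dep_inj D_di _ dI).
have [C [g [Rs [Ss [gI Rs0 [chain1 chain2]]]]]] := IH _ _ RU'.
have gd : map_tuple (g \o d) @` R = map_tuple g @` (map_tuple d @` R).
  by rewrite image_comp; apply: eq_imagel => t _; rewrite /= map_tuple_comp.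
exists C, (g \o d), (fun i => if i is i'.+1 then Rs i' else map_tuple (g \o d) @` R),
  (fun i => if i is i'.+1 then Ss i' else map_tuple g @` S).
have gdI : injective (g \o d) by exact: inj_comp.
split=> //; split=> [[_|i ilt]|[_|i ilt]]; [|exact: chain1| |exact: chain2].
  split; first by apply/(dep_inj D_di _ gdI).
    by move=> /(dep_inj D_di _ gI).
  by rewrite gd; exact: image_subset.
by rewrite Rs0; exact: image_subset.
Qed.

Lemma not_U_undetected (A : Type) (R : set (k.-tuple A)) : ~ U_undetected D R.
Proof.
move=> RU; apply: (no_long_dep_chains D_di D_uc D_sfo) => n.
by have [C [g [Rs [Ss [_ _ ch]]]]] := U_undetected_chain n RU; exists C, Rs, Ss.
Qed.

(** Otherwise every finite list has a counterexample in [D]. Their ultraproduct over lists is in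
    [D], and each candidate sentence fails in it because it belongs to almost all lists: the
    ultraproduct would be undetected. *)
Lemma finite_U_cover : exists l : seq {chi | U_implies_dep D chi},
  forall (A : Type) (R : set (k.-tuple A)), inhabited A -> D A R ->
  exists2 c, c \in (l : seq {classic {chi | U_implies_dep D chi}}) &
    fo_true (rel_structure R) (sval c).
Proof.
apply: contrapT => nex; pose K := {classic {chi | U_implies_dep D chi}}.
have counter (l : seq K) : {d : {A : Type & set (k.-tuple A)} |
    [/\ inhabited (projT1 d), D _ (projT2 d) &
      forall c : K, c \in l -> ~ fo_true (rel_structure (projT2 d)) (sval c)]}.
  apply: cid; apply: contrapT => nd; apply: nex; exists l => A R iA DR.
  apply: contrapT => nc; apply: nd; exists (existT _ A R); split=> // c cl cR.
  by apply: nc; exists c.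
pose A l := projT1 (sval (counter l)).
pose R l : set (k.-tuple (A l)) := projT2 (sval (counter l)).
have [U UU Ucone] := ultrafilter_seq K.
have iA l : inhabited (A l) by have [] := svalP (counter l).
apply: (@not_U_undetected (ultraproduct U A) (ultrarel U R)); split.
- have x l : A l by apply: inhabited_witness.
  by constructor; exact: (ucls U x).
- apply/dep_ultrarel => //; apply: filterS filterT => l _.
  by have [] := svalP (counter l).
- move=> chi Dchi; rewrite fo_true_ultrarel // => chiR.
  have /(filter_ex (F := U))[l [chil cl]] :
      U ([set l | fo_true (rel_structure (R l)) chi] `&`
         [set l : seq K | (exist _ chi Dchi : K) \in l]) by exact: filterI.
  by have [_ _ /(_ _ cl)] := svalP (counter l); apply.
Qed.

End Step.

Lemma fo_true_U_form_FBot k (A : Type) (R : set (k.-tuple A)) :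
  fo_true (rel_structure R) (U_form (m := 0) [::] FBot) <-> R = set0.
Proof.
rewrite fo_true_U_form; split=> [[a [_ H]]|->]; last first.
  by exists [tuple]; split=> //; rewrite big_nil.
by rewrite -subset0 => t /H /(_ Logic.I).
Qed.

(** This sentence takes care of the empty relation, over empty carriers too, which [finite_U_cover]
    leaves out. *)
Lemma U_implies_dep_FBot k (D : dependency k) :
  union_closed D -> U_implies_dep D (U_form (m := 0) [::] FBot).
Proof.
move=> D_uc; split=> [|A R /fo_true_U_form_FBot ->]; last exact: union_closed_set0.
by exists 0, [::], FBot.
Qed.

(* An empty carrier has a nonempty relation only if [k = 0]; such a relation is
   mapped onto the nonempty 0-ary relation over any carrier. *)
Lemma dep_all_of_empty_carrier k (D : dependency k) (A : Type) (R : set (k.-tuple A)) :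
  domain_independent D -> union_closed D ->
  ~ inhabited A -> R !=set0 -> D A R ->
  forall (B : Type) (S : set (k.-tuple B)), D B S.
Proof.
move=> D_di D_uc nA [t Rt] DR B S.
case: (pselect (S = set0)) => [->|/eqP/set0P[s Ss]]; first exact: union_closed_set0.
have k0 (i : 'I_k) : False by apply: nA; constructor; exact: (tnth t i).
have f (a : A) : B by case: nA; constructor.
have fI : injective f by move=> a; case: nA; constructor.
have -> : S = map_tuple f @` R; last exact/(dep_inj D_di R fI).
apply/seteqP; split=> [s' _|s' _].
  by exists t => //; apply: eq_from_tnth => i; case: (k0 i).
by rewrite (_ : s' = s) //; apply: eq_from_tnth => i; case: (k0 i).
Qed.

Theorem theorem4 (k : nat) (D : dependency k)
    (D_domain_independent : domain_independent D)
    (D_union_closed : union_closed D)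
    (D_strongly_first_order : strongly_first_order D) :
  exists (n : nat) (chi : 'I_n -> fo (rel_sig k) 0),
    (forall i, U_sentence (chi i)) /\
    forall (A : Type) (R : set (k.-tuple A)),
      D A R <->
      fo_true (rel_structure R) (\big[@FOr (rel_sig k) 0/FBot]_(i < n) chi i).
Proof.
suff [l lP] : exists l : seq {classic {chi | U_implies_dep D chi}},
    forall (A : Type) (R : set (k.-tuple A)), D A R ->
    exists2 c, c \in l & fo_true (rel_structure R) (sval c).
  exists (size l), (fun i => sval (tnth (in_tuple l) i)); split=> [i|A R].
    by have [] := svalP (tnth (in_tuple l) i).
  rewrite /fo_true fo_sat_bigOr; split=> [/lP[c /(tnthP (in_tuple l))[i ->] cR]|[i _]].
    by exists i; rewrite ?mem_index_enum.
  by have [_] := svalP (tnth (in_tuple l) i); exact.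
(* If [D] holds of everything, a trivially true U-sentence suffices; otherwise no nonempty relation
   over an empty carrier is in [D]. *)
have [Dall|nDall] := pselect (forall (B : Type) (S : set (k.-tuple B)), D B S).
  have top : U_implies_dep D (U_form (m := 0) [::] FTop).
    by split=> [|*]; [exists 0, [::], FTop|exact: Dall].
  exists [:: exist _ _ top] => A R _; exists (exist _ _ top); first exact: mem_head.
  by apply/fo_true_U_form; exists [tuple]; rewrite big_nil.
have [l lP] := finite_U_cover D_domain_independent D_union_closed D_strongly_first_order.
pose bot : {classic {chi | U_implies_dep D chi}} :=
  exist _ _ (U_implies_dep_FBot D_union_closed).
exists (bot :: l) => A R DR.
have [R0|/eqP/set0P R0] := pselect (R = set0).
  by exists bot; [exact: mem_head|exact/fo_true_U_form_FBot].
have [iA|nA] := pselect (inhabited A).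
  by have [c cl cR] := lP A R iA DR; exists c => //; rewrite inE cl orbT.
by case: nDall; exact: dep_all_of_empty_carrier R0 DR.
Qed.
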